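(* Let $\mathcal{B}$ be an algebra in a functional language $\mathtt{L}$, $X$ a finite set, $S\subseteq\mathrm{At}_{\mathtt{L}}(X)$ such that $[S]\neq\mathrm{At}_{\mathtt{L}}(X)$, and $\mathcal{C}=\langle X\mid S\rangle$. Then the following conditions are equivalent: 1) $\mathcal{C}$ is the coordinate algebra of an irreducible algebraic set over $\mathcal{B}$ defined by a system of equations in the language $\mathtt{L}$; 2) $\mathcal{C}$ is discriminated by $\mathcal{B}$; 3) $\mathcal{C}\in\mathbf{Ucl}(\mathcal{B})$ and $\mathcal{B}$ is $\mathrm{u}_S$-compact.
   Context: A functional language $\mathtt{L}$ is a first-order language with function and constant symbols only (and equality); $\mathtt{L}$-structures are called $\mathtt{L}$-algebras. For a finite set of variables $X=\{x_1,\dots,x_n\}$, $\mathcal{T}_{\mathtt{L}}(X)$ is the absolutely free algebra of terms, and $\mathrm{At}_{\mathtt{L}}(X)$ is the set of atomic formulas $(t=s)$ in variables $X$ (equations). For $S\subseteq\mathrm{At}_{\mathtt{L}}(X)$, $[S]$ is the congruent closure of $S$, the least subset of $\mathrm{At}_{\mathtt{L}}(X)$ containing $S$ for which $\{(t,s):(t=s)\in[S]\}$ is a congruence on $\mathcal{T}_{\mathtt{L}}(X)$; $\langle X\mid S\rangle$ denotes the quotient of $\mathcal{T}_{\mathtt{L}}(X)$ by this congruence. $\mathrm{V}_{\mathcal{B}}(S)\subseteq B^n$ is the solution set of $S$ in $\mathcal{B}$; sets of this form are the algebraic sets over $\mathcal{B}$. An algebraic set is irreducible if it is non-empty and is not a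 finite union of proper algebraic subsets. The radical $\mathrm{Rad}(Y)$ of an algebraic set $Y\subseteq B^n$ is the set of all $(t=s)\in\mathrm{At}_{\mathtt{L}}(X)$ holding at all points of $Y$, and the coordinate algebra of $Y$ is $\Gamma(Y)=\mathcal{T}_{\mathtt{L}}(X)/\theta_{\mathrm{Rad}(Y)}$, where $t_1\sim t_2$ iff $(t_1=t_2)\in\mathrm{Rad}(Y)$ (being the coordinate algebra is understood up to isomorphism). $\mathcal{B}$ is $\mathrm{u}_S$-compact (for the fixed $X$ and $S\subseteq\mathrm{At}_{\mathtt{L}}(X)$) if for any atomic formulas $(t_1=s_1),\dots,(t_m=s_m)\in\mathrm{At}_{\mathtt{L}}(X)$, whenever the set of formulas $S\cup\{\neg(t_1=s_1),\dots,\neg(t_m=s_m)\}$ is finitely satisfiable in $\mathcal{B}$ (each finite subset is satisfied by some assignment of elements of $\mathcal{B}$ to the variables), it is satisfiable in $\mathcal{B}$. $\mathbf{Ucl}(\mathcal{B})$ is the class of models of all universal sentences true in $\mathcal{B}$. $\mathcal{C}$ is discriminated by $\mathcal{B}$ if for any finite $W\subseteq C$ there is a homomorphism $h\colon\mathcal{C}\to\mathcal{B}$ injective on $W$ (by convention, the trivial one-element algebra is discriminated by $\mathcal{B}$ iff $\mathcal{B}$ has a trivial subalgebra). *)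

(* Defs.v *)
From HB Require Import structures.
From mathcomp Require Import all_boot.
From mathcomp Require Import boolp classical_sets functions cardinality.

Set Implicit Arguments.
Unset Strict Implicit.
Unset Printing Implicit Defensive.

Local Open Scope classical_set_scope.
Local Open Scope quotient_scope.

(* Constants are the symbols of arity 0. *)
Record language := Language { symb : Type; arity : symb -> nat }.

(* The carrier may be empty here: [term_algebra L 'I_0] is empty when [L] has
   no constants, in which case it has no equations at all. Non-emptiness of a
   structure is assumed explicitly where it is meant. *)
Record algebra (L : language) := Algebra {
  carrier :> Type;
  op : forall f : symb L, ('I_(arity f) -> carrier) -> carrier }.

Arguments op {L} a f args.

Section Morphisms.
Context {L : language}.
Implicit Types A C : algebra L.

Definition is_hom A C (h : A -> C) : Prop :=
  forall (f : symb L) (args : 'I_(arity f) -> A),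
    h (op A f args) = op C f (h \o args).

Definition isomorphic A C : Prop :=
  exists h : A -> C, is_hom h /\ bijective h.

(* For a one-element [C] this says that [A] has a one-element subalgebra. *)
Definition discriminated_by C A : Prop :=
  forall W : set C, finite_set W ->
    exists h : C -> A, is_hom h /\ set_inj W h.

End Morphisms.

Section Quotient.
Context {L : language} (A : algebra L).

Record is_congruence (R : A -> A -> Prop) : Prop := IsCongruence {
  cong_refl : forall a, R a a;
  cong_sym : forall a b, R a b -> R b a;
  cong_trans : forall a b c, R a b -> R b c -> R a c;
  cong_op : forall (f : symb L) (u v : 'I_(arity f) -> A),
    (forall i, R (u i) (v i)) -> R (op A f u) (op A f v) }.

Variables (R : A -> A -> Prop) (cR : is_congruence R).

Definition cong_rel : rel {classic A} := fun a b => `[< R a b >].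

Lemma cong_rel_refl : reflexive cong_rel.
Proof. by move=> a; apply/asboolP/(cong_refl cR). Qed.

Lemma cong_rel_sym : symmetric cong_rel.
Proof. by move=> a b; apply/asboolP/asboolP; apply: (cong_sym cR). Qed.

Lemma cong_rel_trans : transitive cong_rel.
Proof.
by move=> b a c /asboolP ab /asboolP bc; apply/asboolP/(cong_trans cR ab bc).
Qed.

Definition cong_equiv : equiv_rel {classic A} :=
  EquivRel cong_rel cong_rel_refl cong_rel_sym cong_rel_trans.

Definition quot_algebra : algebra L :=
  @Algebra L {eq_quot cong_equiv}
    (fun f args =>
       \pi_({eq_quot cong_equiv})
         (op A f (fun i => repr (args i)) : {classic A})).

Definition quot_proj (a : A) : quot_algebra :=
  \pi_({eq_quot cong_equiv}) (a : {classic A}).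

Lemma quot_projP (a b : A) : quot_proj a = quot_proj b <-> R a b.
Proof.
split=> [/eqquotP /asboolP // | ab].
by apply/eqquotP/asboolP.
Qed.

Lemma quot_proj_hom : is_hom quot_proj.
Proof.
move=> f args; apply/quot_projP/(cong_op cR) => i /=.
by apply/quot_projP; rewrite /quot_proj reprK.
Qed.

End Quotient.

Section Terms.
Context {L : language}.

Inductive term (V : Type) : Type :=
| Var of V
| App (f : symb L) of ('I_(arity f) -> term V).

Definition term_algebra (V : Type) : algebra L := Algebra (@App V).

Fixpoint eval (A : algebra L) (V : Type) (a : V -> A) (t : term V) : A :=
  match t with
  | Var v => a v
  | App f args => op A f (fun i => eval a (args i))
  end.

(* The pair [(t, s)] stands for the atomic formula [t = s]. *)
Definition equation (V : Type) : Type := (term V * term V)%type.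

Inductive qf_formula (V : Type) : Type :=
| Atom of equation V
| Neg of qf_formula V
| And of qf_formula V & qf_formula V
| Or of qf_formula V & qf_formula V
| Imp of qf_formula V & qf_formula V.

Fixpoint holds (A : algebra L) (V : Type) (a : V -> A) (p : qf_formula V)
    : Prop :=
  match p with
  | Atom e => eval a e.1 = eval a e.2
  | Neg q => ~ holds a q
  | And q r => holds a q /\ holds a r
  | Or q r => holds a q \/ holds a r
  | Imp q r => holds a q -> holds a r
  end.

(* [USentence k p] is the sentence [forall x_0 ... x_(k-1), p]. *)
Record universal_sentence := USentence {
  us_nvars : nat;
  us_matrix : qf_formula 'I_us_nvars }.

Definition models (A : algebra L) (phi : universal_sentence) : Prop :=
  forall a : 'I_(us_nvars phi) -> A, holds a (us_matrix phi).

(* [Ucl B C] says that [C] belongs to the universal closure of [B]. *)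
Definition Ucl (B C : algebra L) : Prop :=
  forall phi : universal_sentence, models B phi -> models C phi.

Definition satisfiable (A : algebra L) (V : Type) (P : set (qf_formula V))
    : Prop :=
  exists a : V -> A, forall p, P p -> holds a p.

Definition finitely_satisfiable (A : algebra L) (V : Type)
    (P : set (qf_formula V)) : Prop :=
  forall P0 : set (qf_formula V),
    finite_set P0 -> P0 `<=` P -> satisfiable A P0.

Definition u_compact (A : algebra L) (V : Type) (S : set (equation V))
    : Prop :=
  forall (m : nat) (e : 'I_m -> equation V),
    let P := (@Atom V) @` S `|` range (fun i => Neg (Atom (e i))) in
    finitely_satisfiable A P -> satisfiable A P.

Definition eqn_rel (V : Type) (E : set (equation V))
    : term_algebra V -> term_algebra V -> Prop :=
  fun t s => E (t, s).

Definition cong_closure (V : Type) (S : set (equation V))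
    : set (equation V) :=
  smallest [set E | is_congruence (eqn_rel E)] S.

Lemma cong_closureP (V : Type) (S : set (equation V)) :
  is_congruence (eqn_rel (cong_closure S)).
Proof.
split.
- by move=> a E [cE _]; apply: (cong_refl cE).
- by move=> a b ab E hE; apply: (cong_sym hE.1); apply: ab.
- move=> a b c ab bc E hE.
  by apply: (cong_trans hE.1 (b := b)); [apply: ab | apply: bc].
- by move=> f u v uv E hE; apply: (cong_op hE.1) => i; apply: uv.
Qed.

Definition presented_algebra (V : Type) (S : set (equation V)) : algebra L :=
  quot_algebra (cong_closureP S).

End Terms.

Arguments term : clear implicits.
Arguments term_algebra : clear implicits.
Arguments equation : clear implicits.
Arguments qf_formula : clear implicits.
Arguments universal_sentence : clear implicits.

Section AlgebraicSets.
Context {L : language} (B : algebra L).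
Implicit Types n : nat.

(* [B ^ n] is the type ['I_n -> B]. *)
Definition V_ n (S : set (equation L 'I_n)) : set ('I_n -> B) :=
  [set p | forall e, S e -> eval p e.1 = eval p e.2].

Definition algebraic n (Y : set ('I_n -> B)) : Prop :=
  exists S : set (equation L 'I_n), Y = V_ S.

Definition irreducible n (Y : set ('I_n -> B)) : Prop :=
  Y !=set0 /\
  ~ exists (k : nat) (Z : 'I_k -> set ('I_n -> B)),
      (forall i, algebraic (Z i) /\ Z i `<` Y) /\
      Y = \bigcup_(i in [set: 'I_k]) Z i.

Definition Rad n (Y : set ('I_n -> B)) : set (equation L 'I_n) :=
  [set e | forall p, Y p -> eval p e.1 = eval p e.2].

Lemma RadP n (Y : set ('I_n -> B)) : is_congruence (eqn_rel (Rad Y)).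
Proof.
split.
- by move=> a p _.
- by move=> a b ab p /ab.
- by move=> a b c ab bc p Yp; rewrite (ab p Yp) (bc p Yp).
- move=> f u v uv p Yp /=; congr (op B f _).
  by apply/funext => i; apply: uv.
Qed.

Definition coordinate_algebra n (Y : set ('I_n -> B)) : algebra L :=
  quot_algebra (RadP Y).

(* Coordinate algebras are taken up to isomorphism, and the algebraic set may
   live in any finite power of [B]. *)
Definition is_coordinate_algebra_of_irreducible (C : algebra L) : Prop :=
  exists (n : nat) (Y : set ('I_n -> B)),
    [/\ algebraic Y, irreducible Y & isomorphic C (coordinate_algebra Y)].

End AlgebraicSets.

(* Main.v *)
Require Import Defs.
From mathcomp Require Import all_boot.
From mathcomp Require Import boolp classical_sets functions cardinality.
Local Open Scope classical_set_scope.

(** For a finite family of equations outside [[S]], each of the three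
    conditions yields a point of [V_B(S)] at which all of them fail.
    Conversely, such points give homomorphisms [C -> B] separating prescribed
    pairs, and prevent [V_B(S)] from being a finite union of proper algebraic
    subsets. Finite satisfiability is linked to [[S]] because a consequence
    in [[S]] already follows from a finite part of [S], arities being
    finite. *)

Lemma finite_set_range {T : Type} (A : set T) :
  finite_set A -> exists k (f : 'I_k -> T), A = range f.
Proof.
rewrite -[T]/({classic T} : Type) => /finite_seqP[s ->].
exists (size s), (tnth (in_tuple s)); apply/seteqP; split => [x /= xs|x [i _ <-]].
  have /tnthP[i ->] : x \in in_tuple s by [].
  by exists i.
by rewrite /= mem_tnth.
Qed.

Lemma set_inj_subset {T U : Type} {A D : set T} {h : T -> U} :
  A `<=` D -> set_inj D h -> set_inj A h.
Proof. by move=> AD inj x y; rewrite !inE => /AD ? /AD ?; apply: inj; rewrite inE. Qed.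

Section Homomorphisms.
Context {L : language}.
Implicit Types A B C : algebra L.

Lemma is_hom_comp {A B C} {g : A -> B} {h : B -> C} :
  is_hom g -> is_hom h -> is_hom (h \o g).
Proof. by move=> hg hh f args; rewrite /= hg hh. Qed.

Lemma hom_eval {A B} {h : A -> B} {V : Type} (a : V -> A) (t : term L V) :
  is_hom h -> h (eval a t) = eval (h \o a) t.
Proof.
move=> hh; elim: t => //= f args IH; rewrite hh; congr (op B f _).
exact/funext.
Qed.

Lemma eval_hom {A} {V : Type} (a : V -> A) :
  @is_hom L (term_algebra L V) A (eval a).
Proof. by []. Qed.

Lemma eval_Var (V : Type) (t : term L V) :
  @eval L (term_algebra L V) V (@Var L V) t = t.
Proof. by elim: t => //= f args IH; congr (@App L V f _); apply/funext. Qed.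

Lemma quot_proj_repr {A} {R : A -> A -> Prop} (cR : is_congruence R)
    (x : quot_algebra cR) : quot_proj cR (repr x) = x.
Proof. exact: reprK. Qed.

Lemma quot_lift {A B} {R : A -> A -> Prop} (cR : is_congruence R) (g : A -> B) :
  is_hom g -> (forall a b, R a b -> g a = g b) ->
  exists h : quot_algebra cR -> B,
    is_hom h /\ forall a, h (quot_proj cR a) = g a.
Proof.
move=> hg gR.
have hE a : g (repr (quot_proj cR a)) = g a.
  by apply/gR/(quot_projP cR); rewrite quot_proj_repr.
exists (fun x => g (repr x)); split=> // f args.
by rewrite [LHS]hE hg.
Qed.

Lemma isomorphic_quot {A} {R R' : A -> A -> Prop} (cR : is_congruence R)
    (cR' : is_congruence R') :
  R = R' -> isomorphic (quot_algebra cR) (quot_algebra cR').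
Proof.
move=> RR'; rewrite -{R'}RR' in cR' *.
by rewrite (Prop_irrelevance cR' cR); exists id; split=> //; exists id.
Qed.

Lemma discriminated_by_isomorphic {A B C} :
  isomorphic C A -> discriminated_by A B -> discriminated_by C B.
Proof.
move=> [g [hg /bij_inj gI]] dA W Wfin.
have [h [hh hI]] := dA _ (finite_image g Wfin).
exists (h \o g); split; first exact: is_hom_comp.
move=> x y; rewrite !inE => Wx Wy /= e; apply/gI/hI => //; rewrite inE.
- by exists x.
- by exists y.
Qed.

Lemma holds_hom {A} {V : Type} (a : V -> A) (q : qf_formula L V) :
  exists W : set A, finite_set W /\
    forall B (h : A -> B), is_hom h -> set_inj W h ->
      (holds (h \o a) q <-> holds a q).
Proof.
have bin (P : qf_formula L V -> qf_formula L V -> qf_formula L V) q1 q2 :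
    (exists W : set A, finite_set W /\
       forall B (h : A -> B), is_hom h -> set_inj W h ->
       (holds (h \o a) q1 <-> holds a q1)) ->
    (exists W : set A, finite_set W /\
       forall B (h : A -> B), is_hom h -> set_inj W h ->
       (holds (h \o a) q2 <-> holds a q2)) ->
    (forall B (h : A -> B),
       (holds (h \o a) q1 <-> holds a q1) ->
       (holds (h \o a) q2 <-> holds a q2) ->
       (holds (h \o a) (P q1 q2) <-> holds a (P q1 q2))) ->
    exists W : set A, finite_set W /\
      forall B (h : A -> B), is_hom h -> set_inj W h ->
      (holds (h \o a) (P q1 q2) <-> holds a (P q1 q2)).
  move=> [W1 [fW1 H1]] [W2 [fW2 H2]] HP; exists (W1 `|` W2).
  split=> [|B h hh hI]; first by rewrite finite_setU.
  apply: HP; [apply: H1 => //|apply: H2 => //]; apply: set_inj_subset hI.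
  - exact: subsetUl.
  - exact: subsetUr.
elim: q => [[t s]|q [W [fW H]]|q1 IH1 q2 IH2|q1 IH1 q2 IH2|q1 IH1 q2 IH2].
- exists [set eval a t; eval a s]; split; first exact: finite_set2.
  move=> B h hh hI /=; rewrite -!(hom_eval _ _ hh); split=> [e|-> //].
  by apply: hI e; rewrite inE /=; [left|right].
- exists W; split=> // B h hh hI /=.
  by have [? ?] := H B h hh hI; split; apply: contra_not.
- by apply: (bin (@And L V)) => //= B h; tauto.
- by apply: (bin (@Or L V)) => //= B h; tauto.
- by apply: (bin (@Imp L V)) => //= B h; tauto.
Qed.

Lemma discriminated_by_Ucl {B C} : discriminated_by C B -> Ucl B C.
Proof.
move=> dC phi Bphi a.
have [W [fW HW]] := holds_hom a (us_matrix phi).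
have [h [hh hI]] := dC W fW.
by apply/(HW B h hh hI)/Bphi.
Qed.

Lemma Ucl_satisfiable {B C} {n} (t : term L 'I_n)
    (P : set (qf_formula L 'I_n)) :
  Ucl B C -> finite_set P -> satisfiable C P -> satisfiable B P.
Proof.
move=> UC /finite_set_range[k [f ->]] [a Ca]; apply: contrapT => nB.
pose q s := foldr (fun i => Imp (f i)) (Neg (Atom (t, t))) s.
have holds_q A (b : 'I_n -> A) s :
    holds b (q s) <-> ~ forall i, i \in s -> holds b (f i).
  elim: s => [|i s IH] /=; first by split=> [|/(_ (fun _ => _))] H; exfalso; apply: H.
  split=> [H1 H2|H1 Hi].
    apply: (IH.1 (H1 _)) => [|j js]; apply: H2; rewrite inE ?eqxx //.
    by rewrite js orbT.
  apply/IH => H2; apply: H1 => j; rewrite inE => /predU1P[-> //|]; exact: H2.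
have Bq : models B (USentence (q (enum 'I_k))).
  move=> b; apply/holds_q => Hb; apply: nB; exists b => _ [i _ <-].
  by apply: Hb; rewrite mem_enum.
by have /holds_q := UC _ Bq a; apply=> i _; apply: Ca; exists i.
Qed.

End Homomorphisms.

Section Presentations.
Context {L : language}.
Implicit Types B : algebra L.

Lemma sub_cong_closure {V : Type} {S : set (equation L V)} :
  S `<=` cong_closure S.
Proof. by move=> e Se E [_]; apply. Qed.

Definition generators {V : Type} (S : set (equation L V)) :
    V -> presented_algebra S :=
  quot_proj (cong_closureP S) \o @Var L V.

Lemma eval_generators {V : Type} (S : set (equation L V)) (t : term L V) :
  eval (generators S) t = quot_proj (cong_closureP S) t.
Proof. by rewrite -hom_eval ?eval_Var //; exact: quot_proj_hom. Qed.

Lemma generatorsP {V : Type} {S : set (equation L V)} {e : equation L V} :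
  eval (generators S) e.1 = eval (generators S) e.2 <-> cong_closure S e.
Proof. by case: e => t s; rewrite !eval_generators quot_projP. Qed.

Lemma cong_closure_finite B {V : Type} {S : set (equation L V)} {e} :
  cong_closure S e ->
  exists S0 : set (equation L V), [/\ finite_set S0, S0 `<=` S &
    forall a : V -> B, (forall e', S0 e' -> eval a e'.1 = eval a e'.2) ->
      eval a e.1 = eval a e.2].
Proof.
move=> Se.
pose E := [set e | exists S0 : set (equation L V), [/\ finite_set S0, S0 `<=` S &
    forall a : V -> B, (forall e', S0 e' -> eval a e'.1 = eval a e'.2) ->
      eval a e.1 = eval a e.2]].
apply: (Se E); split; last first.
  move=> e' Se'; exists [set e']; split=> //; first by move=> _ ->.
  by move=> a; apply.
split.
- by move=> t; exists set0; split.
- by move=> t s [S0 [f0 s0 H0]]; exists S0; split=> // a /H0.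
- move=> t s r [S0 [f0 s0 H0]] [S1 [f1 s1 H1]]; exists (S0 `|` S1).
  split; [by rewrite finite_setU | by rewrite subUset | move=> a Ha].
  rewrite [LHS]H0 => [|e' ?]; last by apply: Ha; left.
  by rewrite [LHS]H1 // => e' ?; apply: Ha; right.
- move=> f u v /choice[F HF]; exists (\bigcup_(i in [set: 'I_(arity f)]) F i).
  split.
  + by apply: bigcup_finite => // i _; case: (HF i).
  + by move=> e' [i _]; case: (HF i) => _ + _; apply.
  + move=> a Ha /=; congr (op B f _); apply/funext => i.
    by case: (HF i) => _ _; apply=> e' ?; apply: Ha; exists i.
Qed.

Definition separates {V : Type} B (S : set (equation L V)) : Prop :=
  forall m (e : 'I_m -> equation L V), (forall i, ~ cong_closure S (e i)) ->
    exists2 a : V -> B, (forall e', S e' -> eval a e'.1 = eval a e'.2) &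
      forall i, eval a (e i).1 <> eval a (e i).2.

Lemma discriminated_by_separates {B} {V : Type} (S : set (equation L V)) :
  discriminated_by (presented_algebra S) B -> separates B S.
Proof.
move=> dC m e eS; pose g := generators S.
have Wfin : finite_set (range (fun i => eval g (e i).1) `|`
                        range (fun i => eval g (e i).2)).
  by rewrite finite_setU; split; exact: finite_image.
have [h [hh hI]] := dC _ Wfin; exists (h \o g) => [e' Se'|i].
  rewrite -!(hom_eval _ _ hh); congr h.
  exact: generatorsP.2 (sub_cong_closure _ Se').
rewrite -!(hom_eval _ _ hh) => eq_i; apply: (eS i); apply/generatorsP; apply: hI eq_i;
  rewrite inE; [by left; exists i|by right; exists i].
Qed.

Lemma separates_u_compact {B} {V : Type} (S : set (equation L V)) :
  separates B S -> u_compact B S.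
Proof.
move=> sepS m e P finP.
have [i Se|a aS ae] := sepS m e.
  have [S0 [f0 s0 H0]] := cong_closure_finite B Se.
  have [|x|b Hb] := finP ((@Atom L V) @` S0 `|` [set Neg (Atom (e i))]).
  - by rewrite finite_setU; split=> //; exact: finite_image.
  - by move=> [[e' /s0 ? <-]|->]; [left; exists e'|right; exists i].
  apply: (Hb (Neg (Atom (e i)))); first by right.
  by apply: H0 => e' ?; apply: (Hb (Atom e')); left; exists e'.
by exists a => _ [[e' Se' <-]|[i _ <-]]; [exact: aS|exact: ae].
Qed.

Lemma u_compact_separates {B} n (S : set (equation L 'I_n)) :
  cong_closure S <> [set: equation L 'I_n] ->
  Ucl B (presented_algebra S) -> u_compact B S -> separates B S.
Proof.
move=> /eqP/setTPn[e0 _] UC uS m e eS.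
have [P0 P0fin P0P|a Ha] := uS m e.
  apply: (Ucl_satisfiable e0.1 P0 UC P0fin).
  exists (generators S) => p /P0P[[e' Se' <-]|[i _ <-]] /=.
    exact: generatorsP.2 (sub_cong_closure _ Se').
  by move/generatorsP; exact: eS.
exists a => [e' Se'|i]; first by apply: (Ha (Atom e')); left; exists e'.
by apply: (Ha (Neg (Atom (e i)))); right; exists i.
Qed.

End Presentations.

Section AlgebraicSets.
Context {L : language} {B : algebra L} {n : nat}.

Lemma cong_closure_sub_Rad (S : set (equation L 'I_n)) :
  cong_closure S `<=` Rad (V_ (B := B) S).
Proof. by move=> e; apply; split; [exact: RadP|move=> e' Se' p; apply]. Qed.

Lemma separates_Rad (S : set (equation L 'I_n)) :
  separates B S -> Rad (V_ (B := B) S) = cong_closure S.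
Proof.
move=> sepS; apply/seteqP; split; last exact: cong_closure_sub_Rad.
move=> e Re; apply: contrapT => nSe.
have [//|p Yp] := sepS 1%N (fun=> e); apply; [exact: ord0|exact: Re].
Qed.

Lemma separates_irreducible (S : set (equation L 'I_n)) :
  separates B S -> irreducible (V_ (B := B) S).
Proof.
move=> sepS; split.
  have [|p Yp _] := sepS 0%N (fun i => False_rect _ (notF (ltn_ord i))).
    by case.
  by exists p.
move=> [k [Z [HZ YE]]].
have /choice[e He] i : exists e, ~ cong_closure S e /\
    forall p, Z i p -> eval p e.1 = eval p e.2.
  have [[E ZE] [_ nYZ]] := HZ i.
  apply: contrapT => nex; apply: nYZ => p Yp; rewrite ZE => e Ee.
  apply: (cong_closure_sub_Rad S) (Yp).
  apply: contrapT => nSe; apply: nex; exists e; split=> // p'.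
  by rewrite ZE; apply.
have [i|p Yp ne] := sepS k e; first by case: (He i).
have : V_ S p := Yp; rewrite YE => -[i _ Zip].
by apply: (ne i); case: (He i) => _; apply.
Qed.

Lemma irreducible_discriminated_by (Y : set ('I_n -> B)) :
  algebraic Y -> irreducible Y -> discriminated_by (coordinate_algebra Y) B.
Proof.
move=> [S YE] [_ irrY] W Wfin.
pose D := [set xy | (W `*` W) xy /\ xy.1 <> xy.2].
have /finite_set_range[k [d dE]] : finite_set D.
  by apply: sub_finite_set (finite_setX Wfin Wfin) => xy [].
pose e i : equation L 'I_n := (repr (d i).1, repr (d i).2).
have eK i : ~ Rad Y (e i).
  have [_ nd] : D (d i) by rewrite dE; exists i.
  by move=> /(quot_projP (RadP Y)); rewrite !quot_proj_repr.
have [p Yp pe] : exists2 p, Y p & forall i, eval p (e i).1 <> eval p (e i).2.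
  apply: contrapT => nex; apply: irrY.
  exists k, (fun i => Y `&` [set p | eval p (e i).1 = eval p (e i).2]).
  split=> [i|].
    split.
      exists (S `|` [set e i]); apply/seteqP; split=> p.
        by rewrite YE => -[Sp ei] e' [/Sp|->].
      by rewrite YE => Sp; split=> [e' Se'|]; apply: Sp; [left|right].
    by split=> [p []//|YZ]; apply: (eK i) => p /YZ[].
  apply/seteqP; split=> [p Yp|p [i _ []//]].
  apply: contrapT => nZ; apply: nex; exists p => // i ei.
  by apply: nZ; exists i.
have [h [hh hE]] := quot_lift (RadP Y) (eval p) (eval_hom p)
  (fun t s (ts : Rad Y (t, s)) => ts p Yp).
exists h; split=> // x y; rewrite !inE => Wx Wy hxy; apply: contrapT => nxy.
have : D (x, y) by [].
rewrite dE => -[i _ di]; apply: (pe i).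
by rewrite /e di -!hE !quot_proj_repr.
Qed.

End AlgebraicSets.

Theorem proposition4p15 (L : language) (B : algebra L) (n : nat)
    (S : set (equation L 'I_n)) :
  inhabited B ->
  cong_closure S <> [set: equation L 'I_n] ->
  let C := presented_algebra S in
  [<-> is_coordinate_algebra_of_irreducible B C;
       discriminated_by C B;
       Ucl B C /\ u_compact B S].
Proof.
move=> _ properS C; tfae.
- move=> [m [Y [algY irrY isoY]]].
  exact: discriminated_by_isomorphic isoY (irreducible_discriminated_by Y algY irrY).
- move=> dC; split; first exact: discriminated_by_Ucl.
  exact/separates_u_compact/discriminated_by_separates.
- move=> [UC uS]; have sepS := u_compact_separates n S properS UC uS.
  exists n, (V_ S); split.
  + by exists S.
  + exact: separates_irreducible.
  + by apply: isomorphic_quot; rewrite separates_Rad.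
Qed.
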